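(* The full spectrum of the $n$-tuple of left creation operators $L=(L_1,\dots,L_n)$ on $\mathcal{H}_n$ satisfies $$\overline{\mathbb{B}}_n\cup(\mathbb{C}^n\setminus\mathbb{D}_n)\subseteq\sigma(L),$$ where $\mathbb{B}_n=\{\lambda\in\mathbb{C}^n:\|\lambda\|_2<1\}$ and $\mathbb{D}_n=\{(\lambda_1,\dots,\lambda_n)\in\mathbb{C}^n:|\lambda_i|<1 \text{ for } 1\le i\le n\}$.
   Context: Let $n\ge 2$, let $\mathbb{F}_n^+$ be the unital free semigroup on $n$ noncommuting letters $\{1,\dots,n\}$, and let $\mathcal{H}_n=\ell^2(\mathbb{F}_n^+)$ with orthonormal basis $\{\xi_w:w\in\mathbb{F}_n^+\}$. The left creation operators $L_i\in\mathcal{B}(\mathcal{H}_n)$ are defined by $L_i\xi_w=\xi_{iw}$. For an $n$-tuple $A=(A_1,\dots,A_n)$ of bounded operators on a Hilbert space $\mathcal{H}$: the joint right spectrum $\sigma_r(A)$ is the set of $\lambda\in\mathbb{C}^n$ for which there is no $n$-tuple $B=(B_1,\dots,B_n)$ of bounded operators on $\mathcal{H}$ with $\sum_{i=1}^n(A_i-\lambda_iI)B_i=I$; the joint left spectrum $\sigma_l(A)$ is the set of $\lambda\in\mathbb{C}^n$ for which there is no $n$-tuple $B=(B_1,\dots,B_n)$ of bounded operators on $\mathcal{H}$ with $B_i(A_j-\lambda_jI)=\delta_{ij}I$ for all $1\le i,j\le n$; the full spectrum is $\sigma(A)=\sigma_r(A)\cup\sigma_l(A)$. *)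

(* Defs.v *)
From HB Require Import structures.
From mathcomp Require Import all_boot all_order all_algebra.
From mathcomp Require Import complex.
From mathcomp Require Import all_classical all_reals all_analysis.
From mathcomp Require Import ring lra.

Set Implicit Arguments.
Unset Strict Implicit.
Unset Printing Implicit Defensive.

Import Order.TTheory GRing.Theory Num.Theory.
Import numFieldNormedType.Exports.

Local Open Scope classical_set_scope.
Local Open Scope complex_scope.
Local Open Scope ring_scope.

Import Normc.

(* The Hilbert space ell^2(T) of square-summable families T -> C, where C is
   R[i]. Moduli of complex numbers are taken in R with normc; the norm of a
   normedModType over R[i] takes its values in R[i] itself, hence the embedding
   %:C in ell2_norm. *)

Section Ell2.
Variables (R : realType) (T : choiceType).

Definition square_sum (f : T -> R[i]) : \bar R :=
  \esum_(t in [set: T]) (normc (f t) ^+ 2)%:E.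

Definition square_summable : {pred T -> R[i]} :=
  [pred f | (square_sum f < +oo)%E].

Lemma square_sum_ge0 f : (0 <= square_sum f)%E.
Proof. by apply: esum_ge0 => t _; rewrite lee_fin sqr_ge0. Qed.

Lemma square_sum_le f (M : R) :
  (forall A : set T, finite_set A -> \sum_(t \in A) normc (f t) ^+ 2 <= M) ->
  (square_sum f <= M%:E)%E.
Proof.
move=> fM; apply: ge_ereal_sup => _ [A [finA _] <-].
by rewrite fsumEFin// lee_fin; exact: fM.
Qed.

Lemma le_square_sum f (A : set T) : finite_set A ->
  ((\sum_(t \in A) normc (f t) ^+ 2)%:E <= square_sum f)%E.
Proof. by move=> finA; apply: esum_ge; exists A => //; rewrite fsumEFin. Qed.

Lemma square_summableE f : f \in square_summable ->
  square_sum f = (fine (square_sum f))%:E.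
Proof.
rewrite inE => foo; rewrite fineK// ge0_fin_numE//; exact: square_sum_ge0.
Qed.

Lemma square_summableP f (M : R) :
  (forall A : set T, finite_set A -> \sum_(t \in A) normc (f t) ^+ 2 <= M) ->
  f \in square_summable /\ fine (square_sum f) <= M.
Proof.
move=> /square_sum_le fM.
have fs : f \in square_summable by rewrite inE (le_lt_trans fM)// ltry.
by split=> //; rewrite -lee_fin -square_summableE.
Qed.

Lemma le_fine_square_sum f (A : set T) :
  f \in square_summable -> finite_set A ->
  \sum_(t \in A) normc (f t) ^+ 2 <= fine (square_sum f).
Proof.
by move=> fs finA; rewrite -lee_fin -square_summableE//; exact: le_square_sum.
Qed.

Let finite_bound (f g : T -> R[i]) (a b : R) (A : set T) :
  finite_set A ->
  f \in square_summable -> g \in square_summable -> 0 <= a -> 0 <= b ->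
  (forall h : T -> R[i], (forall t, normc (h t) ^+ 2 <=
     a * normc (f t) ^+ 2 + b * normc (g t) ^+ 2) ->
  \sum_(t \in A) normc (h t) ^+ 2 <=
    a * fine (square_sum f) + b * fine (square_sum g)).
Proof.
move=> finA fs gs a0 b0 h hfg.
have fA := le_fine_square_sum fs finA; have gA := le_fine_square_sum gs finA.
rewrite !fsbig_finite//= in fA gA *.
apply: (le_trans (ler_sum _ (fun t _ => hfg t))).
by rewrite big_split/= -!mulr_sumr lerD// ler_wpM2l.
Qed.

Lemma normc_ge0 (x : R[i]) : 0 <= normc x.
Proof. by case: x => a b; exact: sqrtr_ge0. Qed.

Lemma square_summable_submod_closed : submod_closed square_summable.
Proof.
split.
  apply: (@square_summableP 0 0 _).1 => A finA.
  by rewrite fsbig1// => t _; rewrite (normc0 R) expr0n.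
move=> a f g fs gs.
apply: (square_summableP (f := a *: f + g) (M :=
  (2 * normc a ^+ 2) * fine (square_sum f) + 2 * fine (square_sum g)) _).1.
move=> A finA; apply: finite_bound => //; first by rewrite mulr_ge0 ?sqr_ge0.
move=> t /=; have /(_ (a * f t) (g t)) := @le_normcD R; rewrite normcM.
have := normc_ge0 (a * f t + g t).
have -> : (a *: f + g) t = a * f t + g t by [].
move: (normc (_ + _)) (normc a) (normc (f t)) (normc (g t)).
move=> u v w x u0 uvwx.
rewrite (@le_trans _ _ ((v * w + x) ^+ 2))//.
  by rewrite !expr2 ler_pM.
have := sqr_ge0 (v * w - x); nra.
Qed.

HB.instance Definition _ := GRing.isSubmodClosed.Build _ _ square_summable
  square_summable_submod_closed.

Record ell2 := Ell2 {
  ell2_val :> T -> R[i];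
  ell2_valP : ell2_val \in square_summable }.

HB.instance Definition _ := [isSub for ell2_val].
HB.instance Definition _ := [Choice of ell2 by <:].
HB.instance Definition _ := [SubChoice_isSubLmodule of ell2 by <:].

Definition ell2_norm (f : ell2) : R[i] :=
  (Num.sqrt (fine (square_sum f)))%:C.

Lemma ell2_normE f : ell2_norm f = (Num.sqrt (fine (square_sum f)))%:C.
Proof. by []. Qed.

Lemma ell2_norm0_eq0 f : ell2_norm f = 0 -> f = 0.
Proof.
move=> [] /eqP; rewrite sqrtr_eq0 => f0.
apply/val_inj/funext => t /=; apply: eq0_normc; apply/eqP.
rewrite -sqrf_eq0 eq_le sqr_ge0 andbT (le_trans _ f0)//.
have := le_fine_square_sum (ell2_valP f) (finite_set1 t).
by rewrite fsbig_set1.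
Qed.

Let fine_square_sum_ge0 f : 0 <= fine (square_sum f).
Proof. by rewrite fine_ge0// square_sum_ge0. Qed.

Lemma ell2_normD (f g : ell2) : ell2_norm (f + g) <= ell2_norm f + ell2_norm g.
Proof.
have [f0|f0] := eqVneq (ell2_norm f) 0.
  by rewrite f0 (ell2_norm0_eq0 f0) !add0r.
have [g0|g0] := eqVneq (ell2_norm g) 0.
  by rewrite g0 (ell2_norm0_eq0 g0) !addr0.
have pos (h : ell2) : ell2_norm h != 0 -> 0 < Num.sqrt (fine (square_sum h)).
  move=> h0; rewrite lt_def sqrtr_ge0 andbT.
  by apply: contra_neq h0; rewrite ell2_normE => ->.
rewrite !ell2_normE -rmorphD/= lecR.
have [a0 b0] := (pos _ f0, pos _ g0).
have [fa gb] := (sqr_sqrtr (fine_square_sum_ge0 f),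
                 sqr_sqrtr (fine_square_sum_ge0 g)).
move: (Num.sqrt (fine (square_sum f)))
  (Num.sqrt (fine (square_sum g))) a0 b0 fa gb.
move=> a b a0 b0 fa gb.
have ab0 : 0 < a + b by rewrite addr_gt0.
rewrite -(ger0_norm (ltW ab0)) -sqrtr_sqr ler_wsqrtr//.
apply: (square_summableP _).2 => A finA.
rewrite (_ : (a + b) ^+ 2 = (a + b) / a * fine (square_sum f) +
    (a + b) / b * fine (square_sum g)); last first.
  by rewrite -fa -gb; field; rewrite !gt_eqF.
apply: finite_bound => //; try by rewrite ?ell2_valP.
- by rewrite divr_ge0// ltW.
- by rewrite divr_ge0// ltW.
move=> t; have := le_normcD (f t) (g t).
have := normc_ge0 (f t + g t).
rewrite -[X in normc X ^+ 2 <= _]/(f t + g t).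
move: (normc (_ + _)) (normc (f t)) (normc (g t)) => u v w u0 uvw.
rewrite (@le_trans _ _ ((v + w) ^+ 2))//.
  by rewrite !expr2 ler_pM.
rewrite -subr_ge0 (_ : _ - _ = (b * v - a * w) ^+ 2 / (a * b)).
  by rewrite divr_ge0 ?sqr_ge0// mulr_ge0// ltW.
by field; rewrite !gt_eqF.
Qed.

Let ell2_normZ_le a (f : ell2) : ell2_norm (a *: f) <= `|a| * ell2_norm f.
Proof.
have -> : `|a| = (normc a)%:C by [].
rewrite !ell2_normE -rmorphM/= lecR.
rewrite -[leRHS]ger0_norm ?mulr_ge0 ?normc_ge0 ?sqrtr_ge0//.
rewrite -sqrtr_sqr ler_wsqrtr// exprMn sqr_sqrtr ?fine_square_sum_ge0//.
apply: (square_summableP _).2 => A finA.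
have := le_fine_square_sum (ell2_valP f) finA.
rewrite !fsbig_finite//= => /(ler_wpM2l (sqr_ge0 (normc a))).
apply: le_trans; rewrite mulr_sumr; apply: ler_sum => t _.
rewrite -[X in normc X ^+ 2 <= _]/(a * f t).
by rewrite normcM exprMn.
Qed.

Lemma ell2_normZ a (f : ell2) : ell2_norm (a *: f) = `|a| * ell2_norm f.
Proof.
have [->|a0] := eqVneq a 0.
  apply/le_anti; rewrite ell2_normZ_le normr0 mul0r/=.
  by rewrite ell2_normE lecR sqrtr_ge0.
apply/le_anti; rewrite ell2_normZ_le/= -ler_pdivlMl ?normr_gt0//.
by rewrite -normfV -{1}(scalerK a0 f) ell2_normZ_le.
Qed.

HB.instance Definition _ := Lmodule_isNormed.Build R[i] ell2
  ell2_normD ell2_normZ ell2_norm0_eq0.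

End Ell2.

Arguments square_summable {R T}.
Arguments ell2 : clear implicits.

Section JointSpectrum.
(* Only the norm of the underlying Hilbert space is involved, so V is an
   arbitrary normed space; operator identities are stated pointwise. *)
Variables (K : numFieldType) (V : normedModType K).

Record bounded_operator := BoundedOperator {
  operator_val :> {linear V -> V};
  operator_bounded :
    exists M : K, forall x : V, `|operator_val x| <= M * `|x| }.

Variables (n : nat) (A : 'I_n -> bounded_operator).

Definition right_spectrum : set 'rV[K]_n :=
  [set lambda | ~ exists B : 'I_n -> bounded_operator,
     forall x : V, \sum_(i < n) (A i (B i x) - lambda 0 i *: B i x) = x].

Definition left_spectrum : set 'rV[K]_n :=
  [set lambda | ~ exists B : 'I_n -> bounded_operator,
     forall (i j : 'I_n) (x : V),
       B i (A j x - lambda 0 j *: x) = (i == j)%:R *: x].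

Definition full_spectrum : set 'rV[K]_n := right_spectrum `|` left_spectrum.

End JointSpectrum.

Section CreationOperators.
Variables (R : realType) (n : nat).

(* Words in the letters 'I_n form the free semigroup on n generators, with
   concatenation as product and the empty word as unit. *)
Local Notation word := (seq 'I_n).

Lemma basis_vector_subproof (w : word) :
  (fun v => (v == w)%:R : R[i]) \in square_summable.
Proof.
have sumE : square_sum (fun v => (v == w)%:R : R[i]) = 1%:E.
  rewrite /square_sum -[RHS](@esum_set1 _ _ w (fun=> 1%:E))// esum_mkcond.
  apply: eq_esum => v _; rewrite in_set1.
  by case: eqP => _; rewrite (normc0, normc1) ?expr0n ?expr1n.
by rewrite inE sumE ltry.
Qed.

Definition basis_vector (w : word) : ell2 R word :=
  Ell2 (basis_vector_subproof w).

(* The family of coefficients of sum_v f(v) xi_(iv); left_creation_basis below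
   gives the defining relation L_i xi_w = xi_(iw). *)
Definition prepend_letter (i : 'I_n) (f : word -> R[i]) : word -> R[i] :=
  fun w => if w is j :: v then (if j == i then f v else 0) else 0.

Lemma square_sum_prepend i f : square_sum (prepend_letter i f) = square_sum f.
Proof.
rewrite /square_sum [RHS](_ : _ =
    \esum_(v in setT) (normc (prepend_letter i f (i :: v)) ^+ 2)%:E).
  rewrite -(esum_image setT (cons i)
    (fun w => (normc (prepend_letter i f w) ^+ 2)%:E)).
    rewrite [RHS]esum_mkcond; apply: eq_esum => w _.
    case: ifPn => //; case: w => [|j v] iw /=.
      by rewrite expr0n/= addr0 sqrtr0 expr0n.
    case: (j =P i) iw => [->|_ _]; last by rewrite (normc0 R) expr0n.
    by rewrite notin_setE => -[]; exists v.
  by move=> u v _ _ [].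
by apply: eq_esum => v _; rewrite /= eqxx.
Qed.

Lemma prepend_subproof i (f : ell2 R word) :
  prepend_letter i f \in square_summable.
Proof. by rewrite inE square_sum_prepend; exact: ell2_valP. Qed.

Definition left_creation_fun i (f : ell2 R word) : ell2 R word :=
  Ell2 (prepend_subproof i f).

Lemma left_creation_linear i : linear (left_creation_fun i).
Proof.
move=> a f g; apply/val_inj/funext => -[|j v]; rewrite /= /prepend_letter.
  by rewrite -[RHS]/(a * 0 + 0) mulr0 addr0.
rewrite -[RHS]/(a * (if j == i then f v else 0) + (if j == i then g v else 0)).
by case: ifP => // _; rewrite mulr0 addr0.
Qed.

HB.instance Definition _ i := GRing.isLinear.Build R[i] (ell2 R word)
  (ell2 R word) _ (left_creation_fun i) (left_creation_linear i).

Lemma left_creation_isometry i f : `|left_creation_fun i f| = `|f|.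
Proof.
rewrite -[LHS]/(ell2_norm _) -[RHS]/(ell2_norm _) !ell2_normE/=.
by rewrite square_sum_prepend.
Qed.

Lemma left_creation_bounded i : exists M : R[i], forall f : ell2 R word,
  `|left_creation_fun i f| <= M * `|f|.
Proof. by exists 1 => f; rewrite left_creation_isometry mul1r. Qed.

Definition left_creation (i : 'I_n) : bounded_operator (ell2 R word) :=
  BoundedOperator (left_creation_bounded i).

Lemma left_creation_basis i w :
  left_creation i (basis_vector w) = basis_vector (i :: w).
Proof.
apply/val_inj/funext => -[|j v] //=.
by rewrite eqseq_cons; case: (j == i).
Qed.

End CreationOperators.

Arguments left_creation : clear implicits.

Section Domains.
Variables (R : realType) (n : nat).

Definition norm2 (lambda : 'rV[R[i]]_n) : R :=
  Num.sqrt (\sum_(i < n) normc (lambda 0 i) ^+ 2).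

(* The regular module R[i]^o carries the topology of the complex plane, from
   which row vectors inherit the product topology. *)
Definition unit_ball : set 'rV[R[i]^o]_n := [set lambda | norm2 lambda < 1].

Definition polydisc : set 'rV[R[i]^o]_n :=
  [set lambda | forall i : 'I_n, normc (lambda 0 i) < 1].

End Domains.

Arguments unit_ball : clear implicits.
Arguments polydisc : clear implicits.

(* Main.v *)
(* Fix [lambda] with [sum_i |lambda_i|^2 = r <= 1] and write [lambda^w] for the
   product of the [lambda_i] over the letters of [w]. The functional
   [f |-> sum_(|w| <= N) lambda^w f(w)] sends [(L_i - lambda_i) g] to
   [- lambda_i sum_(|w| = N) lambda^w g(w)], of modulus at most [r^(N/2) |g|].
   If [sum_i (L_i - lambda_i) B_i = 1], applying it to the vector with
   coefficients [conj lambda^w], [|w| <= N], of squared norm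
   [S = 1 + r + ... + r^N], gives [S <= C r^N] for all [N], which is absurd.
   This covers the boundary of the ball together with its interior.

   If [|lambda_i| >= 1] and [B_j (L_k - lambda_k) = delta_jk], take [j <> i]:
   then [B_j L_i = lambda_i B_j] forces [B_j] to kill every basis vector,
   contradicting [B_j (L_j - lambda_j) = 1]. *)
Require Import Defs.
From mathcomp Require Import all_boot all_order all_algebra.
From mathcomp Require Import complex.
From mathcomp Require Import all_classical all_reals all_analysis.
From mathcomp Require Import ring lra.
Set Implicit Arguments.
Unset Strict Implicit.
Unset Printing Implicit Defensive.

Import Order.TTheory GRing.Theory Num.Theory.
Import numFieldNormedType.Exports.
Import Normc.
Local Open Scope classical_set_scope.
Local Open Scope ring_scope.

(** * Moduli of sums and powers, and the Cauchy-Schwarz inequality *)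

Lemma normc_sum (R : realType) (I : Type) (s : seq I) (f : I -> R[i]) :
  normc (\sum_(i <- s) f i) <= \sum_(i <- s) normc (f i).
Proof.
elim: s => [|i s IHs]; first by rewrite !big_nil normc0.
by rewrite !big_cons (le_trans (le_normcD _ _))// lerD2l.
Qed.

Lemma normcX (R : realType) (x : R[i]) (k : nat) :
  normc (x ^+ k) = normc x ^+ k.
Proof.
by elim: k => [|k IHk]; rewrite ?expr0 ?normc1// !exprS normcM IHk.
Qed.

Lemma cauchy_schwarz_sum {R : realType} {I : Type} (s : seq I) (a b : I -> R) :
  (\sum_(i <- s) a i * b i) ^+ 2 <=
  (\sum_(i <- s) a i ^+ 2) * (\sum_(i <- s) b i ^+ 2).
Proof.
elim: s => [|i s IHs]; first by rewrite !big_nil mulr0 expr0n.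
rewrite !big_cons.
have A0 : 0 <= \sum_(j <- s) a j ^+ 2 by apply: sumr_ge0 => *; exact: sqr_ge0.
have B0 : 0 <= \sum_(j <- s) b j ^+ 2 by apply: sumr_ge0 => *; exact: sqr_ge0.
move: IHs A0 B0; set C := \sum_(j <- s) _; set A := \sum_(j <- s) _.
set B := \sum_(j <- s) _; move: (a i) (b i) C A B => x y C A B CAB A0 B0.
(* AM-GM for the cross term, checked on squares: [(2xyC)^2 <= 4x^2y^2AB <= (x^2B + y^2A)^2]. *)
have : 2 * (x * y * C) <= x ^+ 2 * B + y ^+ 2 * A.
  have xB : 0 <= x ^+ 2 * B by rewrite mulr_ge0 ?sqr_ge0.
  have yA : 0 <= y ^+ 2 * A by rewrite mulr_ge0 ?sqr_ge0.
  apply: le_trans (ler_norm _) _.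
  rewrite -(ger0_norm (addr_ge0 xB yA)) -ler_sqr ?nnegrE//.
  rewrite !real_normK ?num_real//.
  have := ler_wpM2l (sqr_ge0 (x * y)) CAB.
  by have := sqr_ge0 (x ^+ 2 * B - y ^+ 2 * A); nra.
by nra.
Qed.

(** * Squared norms and finitely supported vectors *)

Section FiniteVectors.
Variables (R : realType) (n : nat).
Local Notation word := (seq 'I_n).
Local Notation H := (ell2 R word).
Implicit Types (s : seq word) (c : word -> R[i]) (f : H).

Definition normsq f : R := fine (square_sum f).

Lemma normsq_ge0 f : 0 <= normsq f.
Proof. by rewrite fine_ge0// square_sum_ge0. Qed.

Lemma bounded_normsq (B : bounded_operator H) :
  exists2 M : R, 0 <= M & forall f, normsq (B f) <= M * normsq f.
Proof.
have [M BM] := operator_bounded B.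
exists (normc M ^+ 2) => [|f]; first exact: sqr_ge0.
have := BM f.
(* The complex constant [M] need not be real, but its product with the norm of [f] is real and
   nonnegative, so [M] may be replaced by its modulus. *)
have -> : M * `|f| = `|M| * `|f|.
  have M0 : 0 <= M * `|f| by exact: le_trans (BM f).
  by rewrite -(ger0_norm M0) normrM normr_id.
rewrite -[`|M|]/((normc M)%:C%C) -[`|f|]/(ell2_norm f).
rewrite -[`|_|]/(ell2_norm (B f)) !ell2_normE -rmorphM/= lecR => Bf.
rewrite -[leLHS](sqr_sqrtr (normsq_ge0 _)) -[normsq f](sqr_sqrtr (normsq_ge0 _)).
by rewrite -exprMn lerXn2r ?nnegrE ?mulr_ge0 ?sqrtr_ge0// normc_ge0.
Qed.

Lemma sum_le_normsq s f : uniq s ->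
  \sum_(w <- s) normc (f w) ^+ 2 <= normsq f.
Proof.
move=> us; rewrite fsbig_seq//.
by apply: le_fine_square_sum => //; exact: ell2_valP.
Qed.

Definition finite_vector s c : H := \sum_(w <- s) c w *: basis_vector R w.

Lemma finite_vectorE s c (w : word) : uniq s ->
  finite_vector s c w = if w \in s then c w else 0.
Proof.
move=> us; have -> : finite_vector s c w = \sum_(v <- s) c v * (w == v)%:R.
  rewrite /finite_vector; elim: (s) => [|v t IHt]; first by rewrite !big_nil.
  by rewrite !big_cons -IHt.
case: ifPn => ws.
  rewrite (bigD1_seq w)//= eqxx mulr1 big1 ?addr0// => v.
  by rewrite eq_sym => /negPf ->; rewrite mulr0.
rewrite big_seq big1// => v vs; case: eqP => [wv|]; last by rewrite mulr0.
by rewrite wv vs in ws.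
Qed.

Lemma normsq_finite_vector s c : uniq s ->
  normsq (finite_vector s c) = \sum_(w <- s) normc (c w) ^+ 2.
Proof.
move=> us; rewrite /normsq /square_sum.
transitivity (fine (\esum_(w in [set` s]) (normc (c w) ^+ 2)%:E)).
  congr fine; rewrite [RHS]esum_mkcond; apply: eq_esum => w _.
  rewrite finite_vectorE// (_ : (w \in [set` s]) = (w \in s)).
    by case: ifP => // _; rewrite (normc0 R) expr0n.
  by apply/idP/idP; rewrite inE.
rewrite esum_fset; last 2 first.
- exact: finite_seq.
- by move=> w _; rewrite lee_fin sqr_ge0.
by rewrite -fsbig_seq// sumEFin.
Qed.

End FiniteVectors.

(** * The closed ball lies in the right spectrum *)

Section RightSpectrum.
Variables (R : realType) (n : nat) (lambda : 'rV[R[i]]_n).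
Local Notation word := (seq 'I_n).
Local Notation H := (ell2 R word).

(** Listing words by length, without repetition, turns the functionals below into finite sums that
    obey a recursion on the first letter. *)
Fixpoint words (k : nat) : seq word :=
  if k is k'.+1 then [seq i :: w | i <- enum 'I_n, w <- words k'] else [:: [::]].

Fixpoint words_upto (N : nat) : seq word :=
  if N is N'.+1 then words_upto N' ++ words N else words 0.

#[local] Arguments words : simpl never.
#[local] Arguments words_upto : simpl never.

Lemma wordsS k :
  words k.+1 = [seq i :: w | i <- enum 'I_n, w <- words k].
Proof. by []. Qed.

Lemma words_uptoS N : words_upto N.+1 = words_upto N ++ words N.+1.
Proof. by []. Qed.

Lemma size_words k w : w \in words k -> size w = k.
Proof.
elim: k w => [|k IHk] w; first by rewrite inE => /eqP ->.
by rewrite wordsS; case/allpairsP=> -[i v] [_ /IHk <- ->].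
Qed.

Lemma words_uniq k : uniq (words k).
Proof.
elim: k => // k IHk; rewrite wordsS; apply: allpairs_uniq; rewrite ?enum_uniq//.
by move=> [i v] [j w] _ _ [-> ->].
Qed.

Lemma size_words_upto N w : w \in words_upto N -> (size w <= N)%N.
Proof.
elim: N => [|N IHN]; first by rewrite inE => /eqP ->.
by rewrite words_uptoS mem_cat => /orP[/IHN/leqW//|/size_words ->].
Qed.

Lemma words_upto_uniq N : uniq (words_upto N).
Proof.
elim: N => // N IHN; rewrite words_uptoS.
rewrite cat_uniq IHN words_uniq andbT/=; apply/hasPn => w /size_words sw.
by apply/negP => /size_words_upto; rewrite sw ltnn.
Qed.

Lemma big_words (V : nmodType) (F : word -> V) k :
  \sum_(w <- words k.+1) F w = \sum_(i < n) \sum_(w <- words k) F (i :: w).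
Proof. by rewrite wordsS big_allpairs_dep big_enum. Qed.

Lemma big_words_upto (V : nmodType) (F : word -> V) N :
  \sum_(w <- words_upto N) F w = \sum_(k < N.+1) \sum_(w <- words k) F w.
Proof.
elim: N => [|N IHN]; first by rewrite big_ord1.
by rewrite big_ord_recr/= -IHN words_uptoS big_cat.
Qed.

Definition word_eval (w : word) : R[i] := \prod_(i <- w) lambda 0 i.

Definition level_eval (k : nat) (f : H) : R[i] :=
  \sum_(w <- words k) word_eval w * f w.

Definition upto_eval (N : nat) (f : H) : R[i] :=
  \sum_(w <- words_upto N) word_eval w * f w.

Lemma upto_eval_level N f : upto_eval N f = \sum_(k < N.+1) level_eval k f.
Proof. exact: big_words_upto. Qed.

(** Only words starting with [i] contribute: [L_i] raises the level by one, and the new letter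
    brings the factor [lambda_i]. *)
Lemma level_eval_creation k i f :
  level_eval k.+1 (left_creation R n i f) = lambda 0 i * level_eval k f.
Proof.
rewrite /level_eval big_words (bigD1 i)//= [X in _ + X]big1 ?addr0; last first.
  by move=> j /negPf ji; rewrite big1// => w _; rewrite ji mulr0.
rewrite mulr_sumr; apply: eq_bigr => w _.
by rewrite eqxx /word_eval big_cons mulrA.
Qed.

Lemma upto_evalD N f g :
  upto_eval N (f + g) = upto_eval N f + upto_eval N g.
Proof. by rewrite -big_split/=; apply: eq_bigr => w _; exact: mulrDr. Qed.

Lemma upto_evalZ N a f : upto_eval N (a *: f) = a * upto_eval N f.
Proof. by rewrite mulr_sumr; apply: eq_bigr => w _; exact: mulrCA. Qed.

(* Telescoping: only the top level survives. *)
Lemma upto_eval_creation N i f :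
  upto_eval N (left_creation R n i f - lambda 0 i *: f) =
  - (lambda 0 i * level_eval N f).
Proof.
rewrite -scaleNr upto_evalD upto_evalZ !upto_eval_level big_ord_recl.
under eq_bigr do rewrite level_eval_creation.
rewrite -mulr_sumr big_ord_recr/=.
rewrite [level_eval 0 _]big_seq1 mulr0.
by rewrite add0r mulNr mulrDr opprD addrA subrr sub0r.
Qed.

Lemma upto_eval_sum N (I : Type) (s : seq I) (F : I -> H) :
  upto_eval N (\sum_(i <- s) F i) = \sum_(i <- s) upto_eval N (F i).
Proof.
apply: (big_morph _ (upto_evalD N)).
by rewrite /upto_eval big1// => w _; exact: mulr0.
Qed.

Local Notation r := (\sum_(i < n) normc (lambda 0 i) ^+ 2).

(** Since [lambda^w] is multiplicative in [w], summing over the first letter splits off one factor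
    [r]. *)
Lemma sum_word_eval k :
  \sum_(w <- words k) normc (word_eval w) ^+ 2 = r ^+ k.
Proof.
elim: k => [|k IHk].
  by rewrite big_seq1 /word_eval big_nil normc1 expr1n.
rewrite big_words exprS mulr_suml; apply: eq_bigr => i _.
rewrite -IHk mulr_sumr; apply: eq_bigr => w _.
by rewrite /word_eval big_cons normcM exprMn.
Qed.

(** Cauchy-Schwarz over the words of length [k], whose weights have square sum [r ^+ k]. *)
Lemma level_eval_le k f : normc (level_eval k f) ^+ 2 <= r ^+ k * normsq f.
Proof.
apply: (@le_trans _ _
    ((\sum_(w <- words k) normc (word_eval w) * normc (f w)) ^+ 2)).
  have eval_le : normc (level_eval k f) <=
      \sum_(w <- words k) normc (word_eval w) * normc (f w).
    apply: le_trans (normc_sum _ _) _.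
    by under eq_bigr do rewrite normcM.
  by rewrite lerXn2r ?nnegrE ?normc_ge0// (le_trans _ eval_le)// normc_ge0.
apply: le_trans (cauchy_schwarz_sum _ _ _) _.
rewrite sum_word_eval ler_wpM2l ?sum_le_normsq ?words_uniq//.
by rewrite exprn_ge0// sumr_ge0// => i _; exact: sqr_ge0.
Qed.

Lemma closed_ball_right_spectrum : r <= 1 ->
  right_spectrum (left_creation R n) lambda.
Proof.
move=> r1 [B BP].
have r0 : 0 <= r by apply: sumr_ge0 => i _; exact: sqr_ge0.
(* One constant serves all the [B i]: the sum of their individual constants. *)
have [M M0 BM] : exists2 M : R, 0 <= M &
    forall i f, normsq (B i f) <= M * normsq f.
  pose b i := sval (cid2 (bounded_normsq (B i))).
  have b0 i : 0 <= b i by rewrite /b; case: cid2.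
  have bP i f : normsq (B i f) <= b i * normsq f by rewrite /b; case: cid2.
  exists (\sum_(i < n) b i) => [|i f]; first by apply: sumr_ge0.
  apply: le_trans (bP i f) _; rewrite ler_wpM2r ?normsq_ge0//.
  by rewrite (bigD1 i)//= lerDl sumr_ge0.
pose S N : R := \sum_(k < N.+1) r ^+ k.
have S_ge1 N : 1 <= S N.
  rewrite /S big_ord_recl expr0 lerDl.
  by apply: sumr_ge0 => k _; exact: exprn_ge0.
(* As [r <= 1], each of the [N + 1] terms is at least [r ^+ N]; the factor [N + 1] is what settles
   the boundary case [r = 1]. *)
have S_ge N : N.+1%:R * r ^+ N <= S N.
  rewrite mulr_natl -[X in _ *+ X]card_ord -sumr_const.
  by apply: ler_sum => k _; rewrite ler_wiXn2l// -ltnS.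
have S_le N : S N <= n%:R ^+ 2 * M * r ^+ N.
  (* With conjugate coefficients, the functional takes at [x] the value [S N], which is also the
     squared norm of [x]. *)
  pose x := finite_vector (words_upto N) (fun w => conjc (word_eval w)).
  have normc_conj (z : R[i]) : normc (conjc z) = normc z.
    by case: z => a b /=; rewrite sqrrN.
  have xx : normsq x = S N.
    rewrite normsq_finite_vector ?words_upto_uniq// big_words_upto.
    apply: eq_bigr => k _; rewrite -sum_word_eval.
    by apply: eq_bigr => w _; rewrite normc_conj.
  have ex : upto_eval N x = (S N)%:C%C.
    rewrite -xx normsq_finite_vector ?words_upto_uniq// rmorph_sum.
    rewrite /upto_eval big_seq [RHS]big_seq; apply: eq_bigr => w ws.
    rewrite finite_vectorE ?words_upto_uniq// ws normc_conj.
    by rewrite rmorphXn -normCK.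
  have lambda_le1 i : normc (lambda 0 i) <= 1.
    rewrite -(@expr_le1 _ 2) ?normc_ge0// (le_trans _ r1)//.
    rewrite (bigD1 i)//= lerDl; apply: sumr_ge0 => j _; exact: sqr_ge0.
  have SE : (S N)%:C%C = \sum_(i < n) - (lambda 0 i * level_eval N (B i x)).
    rewrite -ex -{1}(BP x) upto_eval_sum.
    by apply: eq_bigr => i _; rewrite upto_eval_creation.
  have S0 : 0 <= S N by exact: le_trans (S_ge1 N).
  (* Each of the [n] summands is bounded by the root; squaring and cancelling one factor [S N >= 1]
     then gives the claim. *)
  have : S N <= n%:R * Num.sqrt (r ^+ N * (M * S N)).
    rewrite [leLHS](_ : _ = normc (\sum_(i < n) - (lambda 0 i * level_eval N (B i x)))); last first.
      by rewrite -SE /= expr0n addr0 sqrtr_sqr ger0_norm.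
    rewrite (le_trans (normc_sum _ _))//.
    rewrite mulr_natl -[X in _ *+ X]card_ord -sumr_const.
    apply: ler_sum => i _; rewrite normcN normcM.
    rewrite (le_trans (ler_piMl _ (lambda_le1 i))) ?normc_ge0//.
    rewrite -[leLHS]ger0_norm ?normc_ge0// -sqrtr_sqr ler_wsqrtr//.
    rewrite (le_trans (level_eval_le _ _))// ler_wpM2l ?exprn_ge0//.
    by rewrite -xx.
  rewrite -(@ler_pXn2r _ 2) ?nnegrE ?mulr_ge0 ?sqrtr_ge0//.
  rewrite exprMn sqr_sqrtr ?mulr_ge0 ?exprn_ge0//.
  rewrite expr2 (_ : _ * (_ * _) = (n%:R ^+ 2 * M * r ^+ N) * S N); last by ring.
  by rewrite ler_pM2r// (lt_le_trans ltr01).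
(* The case [r = 0] is treated apart because [r ^+ N] is cancelled below; there [N = 1] already
   gives [1 <= 0]. *)
have [r_eq0|r_neq0] := eqVneq r 0.
  by have := le_trans (S_ge1 1) (S_le 1%N); rewrite r_eq0 expr1 mulr0 ler10.
have rN N : 0 < r ^+ N by rewrite exprn_gt0// lt_def r_neq0.
(* Cancelling [r ^+ N] leaves [N + 1 <= n^2 M], which fails for this [N]. *)
pose N := Num.bound (n%:R ^+ 2 * M).
have : (n%:R ^+ 2 * M : R) < N%:R.
  by rewrite archi_boundP// mulr_ge0// exprn_ge0.
have := le_trans (S_ge N) (S_le N); rewrite ler_pM2r// => MN /(le_lt_trans MN).
by rewrite ltr_nat ltnNge leqnSn.
Qed.

End RightSpectrum.

(** * The complement of the polydisc lies in the left spectrum *)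

Section LeftSpectrum.
Variables (R : realType) (n : nat) (lambda : 'rV[R[i]]_n).
Local Notation word := (seq 'I_n).
Local Notation H := (ell2 R word).

(* [B] intertwines [L_i] with multiplication by [l], so it maps the vector
   sum_(k < N) l^-k L_i^k xi_w, of norm at most sqrt N, to N B xi_w. *)
Lemma eigen_operator_basis (l : R[i]) (i : 'I_n) (B : bounded_operator H) w :
  1 <= normc l ->
  (forall f : H, B (left_creation R n i f) = l *: B f) ->
  B (basis_vector R w) = 0.
Proof.
move=> l1 BL; have [M M0 BM] := bounded_normsq B.
have l0 : l != 0 by apply: contraTneq l1 => ->; rewrite normc0 ler10.
pose s N := [seq nseq k i ++ w | k <- iota 0 N].
(* Coefficients are functions of the word, so the exponent [k] is read off as the excess length of
   [nseq k i ++ w] over [w]. *)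
pose c (v : word) := l ^- (size v - size w).
have us N : uniq (s N).
  rewrite map_inj_uniq ?iota_uniq// => k m /(congr1 size).
  by rewrite !size_cat !size_nseq => /addIn.
have Bk k : B (basis_vector R (nseq k i ++ w)) = l ^+ k *: B (basis_vector R w).
  elim: k => [|k IHk]; first by rewrite expr0 scale1r.
  by rewrite /= -left_creation_basis BL IHk scalerA exprS.
have BN N : B (finite_vector (s N) c) = N%:R *: B (basis_vector R w).
  rewrite /finite_vector linear_sum big_map.
  transitivity (\sum_(k <- iota 0 N) B (basis_vector R w)).
    apply: eq_bigr => k _; rewrite linearZ/= Bk /c size_cat size_nseq addnK.
    by rewrite scalerA mulVf ?scale1r// expf_neq0.
  by rewrite big_const_seq count_predT size_iota iter_addr_0 scaler_nat.
have norm_le N : normsq (finite_vector (s N) c) <= N%:R.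
  rewrite normsq_finite_vector// big_map.
  rewrite (le_trans (y := \sum_(k <- iota 0 N) 1))//; last first.
    by rewrite big_const_seq count_predT size_iota iter_addr_0.
  apply: ler_sum => k _; rewrite expr_le1 ?normc_ge0// /c normcV normcX.
  by rewrite invf_le1 ?exprn_ege1// exprn_gt0// (lt_le_trans ltr01).
set y := B (basis_vector R w) in BN *.
(* Comparing squared norms gives [N^2 |y v|^2 <= M N]; one factor [N] cancels, and unboundedness of
   [N] will force [y v = 0]. *)
have yM v N : N%:R * normc (y v) ^+ 2 <= M.
  case: N => [|N]; first by rewrite mul0r.
  have := @sum_le_normsq _ _ [:: v] (N.+1%:R *: y) isT.
  rewrite big_seq1 -[(_ *: y) v]/(N.+1%:R * y v) normcM exprMn -BN => yv.
  have := le_trans yv (le_trans (BM _) (ler_wpM2l M0 (norm_le N.+1))).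
  have -> : normc (N.+1%:R : R[i]) = N.+1%:R.
    by rewrite -[LHS]/(complex.Re `|N.+1%:R : R[i]|) normr_nat raddfMn.
  by rewrite [M * _]mulrC expr2 -mulrA ler_pM2l ?ltr0n.
apply/val_inj/funext => v /=; apply: eq0_normc; apply/eqP.
rewrite -sqrf_eq0 eq_le sqr_ge0 andbT leNgt; apply/negP => yv0.
have := yM v (Num.bound (M / normc (y v) ^+ 2)).
rewrite -ler_pdivlMr// leNgt archi_boundP//.
by rewrite divr_ge0// ltW.
Qed.

Lemma exterior_left_spectrum (i j : 'I_n) : i != j ->
  1 <= normc (lambda 0 i) -> left_spectrum (left_creation R n) lambda.
Proof.
move=> ij l1 [B BP].
have B0 := @eigen_operator_basis (lambda 0 i) i (B j) _ l1 _.
have {}B0 w : B j (basis_vector R w) = 0.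
  apply: B0 => f; apply/eqP; rewrite -subr_eq0 -linearZ -linearB BP.
  by rewrite [_ == i]eq_sym (negPf ij) scale0r.
(* At the empty word the diagonal equation now equates [0] with a basis vector, whose coefficient
   there is [1]. *)
have := BP j j (basis_vector R [::]).
rewrite left_creation_basis linearB linearZ/= !B0 scaler0 subr0 eqxx scale1r.
move=> /(congr1 (fun f : H => f [::])) /eqP.
by rewrite eq_sym -[X in X == _]/(1%:R) oner_eq0.
Qed.

End LeftSpectrum.

(** * The closure of the ball, and the final inclusion *)

Lemma closure_unit_ball_le (R : realType) (n : nat) (lambda : 'rV[R[i]^o]_n) :
  closure (unit_ball R n) lambda ->
  \sum_(i < n) normc (lambda 0 i) ^+ 2 <= 1.
Proof.
move=> cl; apply/ler_addgt0Pr => e e0.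
(* For [|mu_i| <= 1] and [d <= 1], [(|mu_i| + d)^2 <= |mu_i|^2 + 3d]; the total excess [3nd] must
   stay below [e], and [n + 1] keeps the denominator nonzero. *)
pose d := Num.min 1 (e / (3 * n.+1%:R)).
have d0 : 0 < d by rewrite lt_min ltr01 divr_gt0// mulr_gt0.
have [mu [mu1 mud]] := cl _ (nbhsx_ballx lambda (d%:C%C) ltac:(by rewrite ltcR)).
have {}mu1 : \sum_(i < n) normc (mu 0 i) ^+ 2 < 1.
  by move: mu1; rewrite /unit_ball/= /norm2 -[ltRHS]sqrtr1 ltr_sqrt.
have mu_le1 i : normc (mu 0 i) <= 1.
  rewrite -(@expr_le1 _ 2) ?normc_ge0// (le_trans _ (ltW mu1))//.
  by rewrite (bigD1 i)//= lerDl; apply: sumr_ge0 => j _; exact: sqr_ge0.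
have lambda_le i : normc (lambda 0 i) <= normc (mu 0 i) + d.
  have /ltW : `|(lambda 0 i : R[i]) - mu 0 i| < d%:C%C by exact: (mud.2 0 i).
  rewrite lecR -(lerD2l (normc (mu 0 i))).
  apply: le_trans; have := le_normcD (mu 0 i) (lambda 0 i - mu 0 i).
  by rewrite addrC subrK.
apply: (@le_trans _ _ (\sum_(i < n) (normc (mu 0 i) ^+ 2 + 3 * d))).
  apply: ler_sum => i _.
  have := lambda_le i; have := mu_le1 i.
  have := normc_ge0 (lambda 0 i); have := normc_ge0 (mu 0 i).
  have : d <= 1 by rewrite ge_min lexx.
  move: (normc (lambda 0 i)) (normc (mu 0 i)) => u v d1 v0 u0 v1 uv.
  by rewrite (@le_trans _ _ ((v + d) ^+ 2)) ?lerXn2r ?nnegrE//; nra.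
rewrite big_split/= lerD ?(ltW mu1)// sumr_const card_ord -[leLHS]mulr_natl.
have : d <= e / (3 * n.+1%:R) by rewrite ge_min lexx orbT.
rewrite ler_pdivlMr ?mulr_gt0//; apply: le_trans.
by rewrite mulrCA [leRHS]mulrCA ler_wpM2l// mulrC ler_wpM2l ?ler_nat// ltW.
Qed.

Theorem corollary5p4 (R : realType) (n : nat) (n_ge2 : (2 <= n)%N) :
  closure (unit_ball R n) `|` ~` (polydisc R n)
    `<=` full_spectrum (left_creation R n).
Proof.
move=> lambda [/closure_unit_ball_le r1|].
  by left; exact: closed_ball_right_spectrum.
move=> /existsNP[i /negP]; rewrite -leNgt => l1; right.
(* Here [n >= 2] enters: [j] is the first letter, or the second one when [i] is the first. *)
have [j ij] : exists j : 'I_n, i != j.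
  have n0 : (0 < n)%N by exact: ltnW.
  have [->|] := eqVneq i (Ordinal n0); last by exists (Ordinal n0).
  by exists (Ordinal n_ge2).
exact: exterior_left_spectrum ij l1.
Qed.
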